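(* Let $\mu_1,\mu_2$ be functions of $(\gamma_1,\gamma_2,\gamma_3)$ which are solutions of the partial differential equation $$\gamma_3\Big(\frac{\partial \mu_1}{\partial\gamma_2}-\frac{\partial \mu_2}{\partial\gamma_1}\Big)-\gamma_2\frac{\partial\mu_1}{\partial\gamma_3}+\gamma_1\frac{\partial\mu_2}{\partial\gamma_3}=0 ,$$ and suppose that the potential function $U$ is determined by $$U=\frac{1}{2I_1I_2}\big(I_1\mu_1^2+I_2\mu_2^2\big)-h ,$$ with $h$ a constant. Then the equations of the Suslov problem with this potential, $$\begin{cases} I_1\dot\omega_1=\gamma_3\,\partial_{\gamma_2}U-\gamma_2\,\partial_{\gamma_3}U,\\ I_2\dot\omega_2=\gamma_1\,\partial_{\gamma_3}U-\gamma_3\,\partial_{\gamma_1}U,\\ (I_1-I_2)\omega_1\omega_2+\gamma_2\,\partial_{\gamma_1}U-\gamma_1\,\partial_{\gamma_2}U+\mu=0,\\ \dot\gamma_1=-\gamma_3\omega_2,\\ \dot\gamma_2=\gamma_3\omega_1,\\ \dot\gamma_3=\gamma_1\omega_2-\gamma_2\omega_1,\end{cases}$$ admit the first integrals $$I_1\omega_1=\mu_2,\qquad I_2\omega_2=-\mu_1 .$$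
   Context: The Suslov problem concerns the rotational motion of a rigid body about a fixed point, with inertial moments $I_1,I_2,I_3$ (inertia matrix $I=\mathrm{diag}(I_1,I_2,I_3)$) and body angular velocity $\omega=(\omega_1,\omega_2,\omega_3)$, subject to the non-holonomic constraint $(\tilde{\mathbf a},\omega)=0$ with $\tilde{\mathbf a}=(0,0,1)$, that is $\omega_3=0$, in a force field with potential $U(\gamma_1,\gamma_2,\gamma_3)$. Here $\gamma=(\gamma_1,\gamma_2,\gamma_3)=(\sin z\sin x,\ \sin z\cos x,\ \cos z)$, with $x,z$ angular coordinates on the configuration space $SO(3)$, and $\mu$ is the Lagrange multiplier.
   Formalization: ''First integrals'' is read as joint invariance: a solution satisfying both relations at one time satisfies them always; I1ω1−μ2 and I2ω2+μ1 need not be constant on other solutions (e.g. μ1=0, μ2=γ2). μ1, μ2 are taken C^1 on an open domain. *)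

(* Defs.v *)
From HB Require Import structures.
From mathcomp Require Import all_boot all_order all_algebra.
From mathcomp Require Import all_classical all_reals all_analysis.

Set Implicit Arguments.
Unset Strict Implicit.
Unset Printing Implicit Defensive.

Import Order.TTheory GRing.Theory Num.Theory.
Import numFieldNormedType.Exports.

Local Open Scope classical_set_scope.
Local Open Scope ring_scope.

(* 0-based positions in 'rV[R]_3 of the coordinates with indices 1, 2, 3 *)
Definition i1 : 'I_3 := @Ordinal 3 0 isT.
Definition i2 : 'I_3 := @Ordinal 3 1 isT.
Definition i3 : 'I_3 := @Ordinal 3 2 isT.

Definition partial (R : realType) (k : 'I_3) (f : 'rV[R]_3 -> R)
    (x : 'rV[R]_3) : R :=
  'D_(delta_mx 0 k : 'rV[R]_3) f x.

(* For open D, continuity at a point of D of the total function [partial k f]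
   only depends on its values in D. *)
Definition C1_on (R : realType) (D : set 'rV[R]_3) (f : 'rV[R]_3 -> R) : Prop :=
  forall x, D x ->
    differentiable f x /\ forall k : 'I_3, {for x, continuous (partial k f)}.

(* The constraint omega_3 = 0 is built in: only omega_1 = w1 and omega_2 = w2
   appear, and the third Euler equation determines the multiplier mu. *)
Record suslov_solution (R : realType) (I1 I2 : R) (U : 'rV[R]_3 -> R)
    (J : set R) (w1 w2 : R -> R) (g : R -> 'rV[R]_3) (mu : R -> R) : Prop :=
  SuslovSolution {
    suslov_w1 : forall t, J t ->
      is_derive t 1 w1
        ((g t 0 i3 * partial i2 U (g t) - g t 0 i2 * partial i3 U (g t)) / I1);
    suslov_w2 : forall t, J t ->
      is_derive t 1 w2
        ((g t 0 i1 * partial i3 U (g t) - g t 0 i3 * partial i1 U (g t)) / I2);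
    suslov_multiplier : forall t, J t ->
      (I1 - I2) * w1 t * w2 t + g t 0 i2 * partial i1 U (g t)
        - g t 0 i1 * partial i2 U (g t) + mu t = 0;
    suslov_g1 : forall t, J t ->
      is_derive t 1 (fun s => g s 0 i1) (- (g t 0 i3 * w2 t));
    suslov_g2 : forall t, J t ->
      is_derive t 1 (fun s => g s 0 i2) (g t 0 i3 * w1 t);
    suslov_g3 : forall t, J t ->
      is_derive t 1 (fun s => g s 0 i3) (g t 0 i1 * w2 t - g t 0 i2 * w1 t)
  }.

(* "The system admits the first integrals P", where P is a system of relations
   between (omega_1, omega_2, gamma) without arbitrary constants: P defines an
   invariant set of the phase space R x R x D.  In general the functions
   I1 * omega_1 - mu2 and I2 * omega_2 + mu1 are not constant along the
   solutions on which they do not vanish (e.g. mu1 = 0, mu2 = gamma_2). *)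
Definition suslov_admits_integrals (R : realType) (I1 I2 : R)
    (U : 'rV[R]_3 -> R) (D : set 'rV[R]_3)
    (P : R -> R -> 'rV[R]_3 -> Prop) : Prop :=
  forall (J : set R) (w1 w2 : R -> R) (g : R -> 'rV[R]_3) (mu : R -> R),
    open J -> is_interval J ->
    (forall t, J t -> D (g t)) ->
    suslov_solution I1 I2 U J w1 w2 g mu ->
    forall t0, J t0 -> P (w1 t0) (w2 t0) (g t0) ->
    forall t, J t -> P (w1 t) (w2 t) (g t).

(* Main.v *)
Require Import Defs.
From HB Require Import structures.
From mathcomp Require Import all_boot all_order all_algebra.
From mathcomp Require Import all_classical all_reals all_analysis.
From mathcomp Require Import ring lra.

Set Implicit Arguments.
Unset Strict Implicit.
Unset Printing Implicit Defensive.

Import Order.TTheory GRing.Theory Num.Theory.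
Import numFieldNormedType.Exports.

Local Open Scope classical_set_scope.
Local Open Scope ring_scope.

(** Let [X1 = rotfield i3 i2] and [X2 = rotfield i1 i3] be the derivations along
    rotations about the first two axes.  The equations of motion read
    [I1 * w1' = X1 U] and [I2 * w2' = X2 U]; along a solution every function of
    [gamma] satisfies [f' = w1 * X1 f + w2 * X2 f] (is_derive_along_solution);
    and the partial differential equation is [X1 mu1 + X2 mu2 = 0].  For the
    quadratic potential,
    [Xi U = mu1 / I2 * Xi mu1 + mu2 / I1 * Xi mu2].

    Consider the defects [p = I1 * w1 - mu2] and [q = I2 * w2 + mu1].  Put
    [A = X1 mu2], [B = X1 mu1 = - X2 mu2] and [C = X2 mu1].  Substituting the
    above, all terms combine into a homogeneous linear system
    [p' = - A / I1 * p + B / I2 * q],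
    [q' = B / I1 * p + C / I2 * q].
    The partial differential equation is exactly what turns the mixed terms
    [w2 * X2 mu2] and [mu2 / I1 * X2 mu2] into multiples of [B], so that they
    fit this shape.  The coefficients are continuous in time because [mu1] and
    [mu2] are of class C1, so a solution vanishing at one time of the interval
    vanishes throughout (linear_system2_eq0, by Gronwall's argument in
    eq0_of_derive_bound).  That is the invariance of the relations
    [I1 * w1 = mu2], [I2 * w2 = - mu1]. *)

(** * Derivatives along curves of row vectors *)

Lemma is_derive_rV (R : realType) (n : nat) (g : R -> 'rV[R]_n)
    (v : 'I_n -> R) (t : R) :
  (forall j, is_derive t 1 (fun s => g s 0 j) (v j)) ->
  is_derive t 1 g (\row_j v j).
Proof.
move=> gv.
have gE : g = \sum_j (fun s => g s 0 j *: (delta_mx 0 j : 'rV[R]_n)).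
  by apply/funext => s; rewrite fct_sumE; exact: row_sum_delta.
have -> : \row_j v j = \sum_j v j *: (delta_mx 0 j : 'rV[R]_n).
  by rewrite [LHS]row_sum_delta; apply: eq_bigr => j _; rewrite mxE.
rewrite gE; apply: is_derive_sum => j.
have dj : differentiable (fun s => g s 0 j) t.
  by apply/derivable1_diffP; case: (gv j).
have djZ := differentiableZl (delta_mx 0 j : 'rV[R]_n) dj.
apply: DeriveDef; first exact/derivable1_diffP.
by rewrite deriveE // diffZl //= -deriveE // (@derive_val _ _ _ _ _ _ _ (gv j)).
Qed.

(** The chain rule along a curve.  Total differentiability of [f] at the point
    is essential: it is what makes the directional derivative linear in the
    direction, hence a combination of the partial derivatives. *)
Lemma is_derive_comp_rV (R : realType) (n : nat) (f : 'rV[R]_n -> R)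
    (g : R -> 'rV[R]_n) (v : 'rV[R]_n) (t : R) :
  is_derive t 1 g v -> differentiable f (g t) ->
  is_derive t 1 (fun s => f (g s))
    (\sum_j v 0 j * 'D_(delta_mx 0 j : 'rV[R]_n) f (g t)).
Proof.
move=> gv df.
have dg : differentiable g t by apply/derivable1_diffP; case: gv.
have dfg : differentiable (f \o g) t by exact: differentiable_comp.
apply: DeriveDef; first exact/derivable1_diffP.
rewrite (deriveE _ dfg) diff_comp //= -(deriveE _ dg) derive_val.
rewrite [in LHS](row_sum_delta v) linear_sum; apply: eq_bigr => j _.
by rewrite linearZ /= deriveE.
Qed.

(** * Uniqueness for linear differential equations *)

(** Gronwall's argument in both time directions at once.  If [K] bounds [k] on
    the segment, then [f t * expR (- K t)] is nonincreasing, so a zero of [f]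
    at [a] propagates to [b]; and [f t * expR (K t)] is nondecreasing, so a
    zero at [b] propagates back to [a].  Having both implications is what lets
    an initial condition sit inside an interval instead of at its left end. *)
Lemma eq0_of_derive_bound (R : realType) (f df k : R -> R) (a b : R) :
  a <= b ->
  (forall t, t \in `[a, b] -> 0 <= f t) ->
  (forall t, t \in `[a, b] -> is_derive t 1 f (df t)) ->
  {within `[a, b], continuous k} ->
  (forall t, t \in `[a, b] -> `|df t| <= k t * f t) ->
  (f a == 0) = (f b == 0).
Proof.
move=> ab f0 fd kc dfk.
have [c _ kle] := EVT_max ab kc.
pose e m t := f t * expR (m * t).
pose de m t := (df t + m * f t) * expR (m * t).
have ede m t : t \in `[a, b] -> is_derive t 1 (e m) (de m t).
  move=> /fd ?; have : is_derive t 1 (fun s => expR (m * s)) (expR (m * t) * m).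
    apply: (@is_derive1_comp _ expR (fun s => m * s)).
    by apply: is_derive_eq; rewrite /GRing.scale /= mulr1.
  move=> ?; apply: is_derive_eq.
  by rewrite /de /GRing.scale /=; ring.
(* Only the values [m = - k c] and [m = k c] matter: the sign of [de m] is then
   constant on the segment. *)
have emvt m : exists2 x, x \in `[a, b] & e m b - e m a = de m x * (b - a).
  have dem x : x \in `]a, b[ -> is_derive x 1 (e m) (de m x).
    rewrite in_itv => /andP[/ltW ax /ltW xb].
    by apply: ede; rewrite in_itv /= ax xb.
  apply: (MVT_segment ab dem).
  by apply: derivable_within_continuous => x /(ede m) [].
have df_bound t : t \in `[a, b] -> `|df t| <= k c * f t.
  by move=> tab; rewrite (le_trans (dfk _ tab)) // ler_wpM2r ?f0 ?kle.
have fa0 : 0 <= f a by rewrite f0 // in_itv /= lexx.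
have fb0 : 0 <= f b by rewrite f0 // in_itv /= lexx ab.
apply/idP/idP => /eqP f_eq0.
  have [x xab] := emvt (- k c).
  rewrite /e f_eq0 mul0r subr0 => fbE.
  have : f b * expR (- k c * b) <= 0.
    rewrite fbE mulr_le0_ge0 ?subr_ge0 //.
    rewrite /de mulr_le0_ge0 ?expR_ge0 //.
    by have := df_bound x xab; rewrite ler_norml => /andP[_]; lra.
  by rewrite pmulr_lle0 ?expR_gt0 // => fb_le0; rewrite eq_le fb_le0.
have [x xab] := emvt (k c).
rewrite /e f_eq0 mul0r sub0r => faE.
have : f a * expR (k c * a) <= 0.
  rewrite -oppr_ge0 faE mulr_ge0 ?subr_ge0 //.
  rewrite /de mulr_ge0 ?expR_ge0 //.
  by have := df_bound x xab; rewrite ler_norml => /andP[+ _]; lra.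
by rewrite pmulr_lle0 ?expR_gt0 // => fa_le0; rewrite eq_le fa_le0.
Qed.

(** Uniqueness of the zero solution of a planar linear system: the squared norm
    [p ^+ 2 + q ^+ 2] grows at most at the continuous rate [k] below, so
    Gronwall's argument applies on the segment between [t0] and [t], which
    lies in [J]. *)
Lemma linear_system2_eq0 (R : realType) (J : set R) (a b c d p q : R -> R) :
  is_interval J ->
  (forall t, J t -> {for t, continuous a}) ->
  (forall t, J t -> {for t, continuous b}) ->
  (forall t, J t -> {for t, continuous c}) ->
  (forall t, J t -> {for t, continuous d}) ->
  (forall t, J t -> is_derive t 1 p (a t * p t + b t * q t)) ->
  (forall t, J t -> is_derive t 1 q (c t * p t + d t * q t)) ->
  forall t0, J t0 -> p t0 = 0 -> q t0 = 0 ->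
  forall t, J t -> p t = 0 /\ q t = 0.
Proof.
move=> itvJ ca cb cc cd dp dq t0 Jt0 p0 q0 t Jt.
pose N s := p s ^+ 2 + q s ^+ 2.
pose k s := 2 * (`|a s| + `|b s| + `|c s| + `|d s|).
have N_eq0 s : (N s == 0) = (p s == 0) && (q s == 0).
  by rewrite /N paddr_eq0 ?sqr_ge0 // !sqrf_eq0.
suff : N t == 0 by rewrite N_eq0 => /andP[/eqP ? /eqP ?].
have Nt0 : N t0 == 0 by rewrite N_eq0 p0 q0 eqxx.
have dN s : J s -> is_derive s 1 N
    (2 * p s * (a s * p s + b s * q s) + 2 * q s * (c s * p s + d s * q s)).
  move=> Js; have ? := dp _ Js; have ? := dq _ Js.
  apply: is_derive_eq; rewrite /GRing.scale /=; ring.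
have kc s : J s -> {for s, continuous k}.
  move=> Js; apply: cvgMr.
  by apply: cvgD; [apply: cvgD; [apply: cvgD|]|];
    apply: cvg_norm; [exact: ca|exact: cb|exact: cc|exact: cd].
have Nk s : `|2 * p s * (a s * p s + b s * q s)
              + 2 * q s * (c s * p s + d s * q s)| <= k s * N s.
  have bound (x y z : R) : `|x * (2 * y * z)| <= `|x| * (y ^+ 2 + z ^+ 2).
    rewrite normrM; apply: ler_wpM2l => //.
    rewrite ler_norml; apply/andP; split.
      by have := sqr_ge0 (y + z); rewrite sqrrD; lra.
    by have := sqr_ge0 (y - z); rewrite sqrrB; lra.
  (* Each coefficient multiplies a product of two of [p s] and [q s], to which
     the inequality above applies. *)
  have -> : 2 * p s * (a s * p s + b s * q s)
              + 2 * q s * (c s * p s + d s * q s)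
     = (a s * (2 * p s * p s) + d s * (2 * q s * q s))
       + (b s * (2 * p s * q s) + c s * (2 * p s * q s)) by ring.
  rewrite (le_trans (ler_normD _ _)) //.
  have := ler_normD (a s * (2 * p s * p s)) (d s * (2 * q s * q s)).
  have := ler_normD (b s * (2 * p s * q s)) (c s * (2 * p s * q s)).
  have := bound (a s) (p s) (p s); have := bound (b s) (p s) (q s).
  have := bound (c s) (p s) (q s); have := bound (d s) (q s) (q s).
  have := mulr_ge0 (normr_ge0 (a s)) (sqr_ge0 (q s)).
  have := mulr_ge0 (normr_ge0 (b s)) (sqr_ge0 (q s)).
  have := mulr_ge0 (normr_ge0 (c s)) (sqr_ge0 (q s)).
  have := mulr_ge0 (normr_ge0 (d s)) (sqr_ge0 (p s)).
  have := mulr_ge0 (normr_ge0 (b s)) (sqr_ge0 (p s)).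
  have := mulr_ge0 (normr_ge0 (c s)) (sqr_ge0 (p s)).
  by rewrite /k /N; lra.
have N_ends x y : J x -> J y -> x <= y -> (N x == 0) = (N y == 0).
  move=> Jx Jy xy.
  have sJ s : s \in `[x, y] -> J s.
    by rewrite in_itv => /andP[? ?]; apply: (itvJ x y) => //; apply/andP.
  apply: (eq0_of_derive_bound (k := k) xy _ (fun s sxy => dN s (sJ s sxy))).
  - by move=> s _; rewrite addr_ge0 ?sqr_ge0.
  - by apply: continuous_subspace_itv => s /sJ; exact: kc.
  - by move=> s _; exact: Nk.
have [tt0|t0t] := leP t t0; first by rewrite (N_ends _ _ Jt Jt0).
by rewrite -(N_ends _ _ Jt0 Jt) // ltW.
Qed.

(** * Rotation fields and the Suslov equations *)

(** The derivative of [f] along an infinitesimal rotation in the plane of the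
    coordinates [i] and [j].  The equations for [omega_1], [omega_2], the partial
    differential equation for [mu1, mu2] and the time derivative of a function
    of [gamma] contain partial derivatives only through the combinations
    [rotfield i3 i2] and [rotfield i1 i3], which turns the computation into
    algebra with two derivations. *)
Definition rotfield (R : realType) (i j : 'I_3) (f : 'rV[R]_3 -> R)
    (x : 'rV[R]_3) : R :=
  x 0 i * partial j f x - x 0 j * partial i f x.

(** The potential is prescribed on [D] only; as [D] is open, the formula holds
    near [x] and may be differentiated. *)
Lemma partial_quadratic_potential (R : realType) (I1 I2 h : R)
    (D : set 'rV[R]_3) (mu1 mu2 U : 'rV[R]_3 -> R) (k : 'I_3) (x : 'rV[R]_3) :
  I1 != 0 -> I2 != 0 -> open D -> D x ->
  differentiable mu1 x -> differentiable mu2 x ->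
  (forall y, D y ->
    U y = (I1 * mu1 y ^+ 2 + I2 * mu2 y ^+ 2) / (2 * I1 * I2) - h) ->
  partial k U x = mu1 x / I2 * partial k mu1 x + mu2 x / I1 * partial k mu2 x.
Proof.
move=> I10 I20 oD Dx d1 d2 hU.
have UE : \near x, U x = ((2 * I2)^-1 *: mu1 ^+ 2 + (2 * I1)^-1 *: mu2 ^+ 2
                          - cst h) x.
  have : \near x, D x by exact: open_nbhs_nbhs.
  apply: filterS => y /hU ->; rewrite /= !fctE /GRing.scale /=.
  by field; rewrite I10 I20.
rewrite /partial (near_eq_derive _ UE).
have der f : differentiable f x ->
    is_derive x (delta_mx 0 k : 'rV[R]_3) f (partial k f x).
  by move=> df; apply: DeriveDef => //; exact: diff_derivable.
have ? := der _ d1; have ? := der _ d2.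
rewrite derive_val /GRing.scale /= /partial.
by field; rewrite I10 I20.
Qed.

Lemma sum_i123 (V : nmodType) (F : 'I_3 -> V) :
  \sum_j F j = F i1 + F i2 + F i3.
Proof.
rewrite !big_ord_recl big_ord0 addr0 addrA.
by congr (F _ + F _ + F _); exact: val_inj.
Qed.

Lemma is_derive_poisson (R : realType) (I1 I2 : R) (U : 'rV[R]_3 -> R)
    (J : set R) (w1 w2 : R -> R) (g : R -> 'rV[R]_3) (mu : R -> R)
    (sol : suslov_solution I1 I2 U J w1 w2 g mu) (t : R) :
  J t ->
  is_derive t 1 g (\row_j
    if j == i1 then - (g t 0 i3 * w2 t) else
    if j == i2 then g t 0 i3 * w1 t else g t 0 i1 * w2 t - g t 0 i2 * w1 t).
Proof.
move=> Jt; apply: is_derive_rV => -[[|[|[|//]]] Hj].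
- by rewrite (_ : Ordinal Hj = i1); [exact: suslov_g1 sol _ Jt|exact: val_inj].
- by rewrite (_ : Ordinal Hj = i2); [exact: suslov_g2 sol _ Jt|exact: val_inj].
- by rewrite (_ : Ordinal Hj = i3); [exact: suslov_g3 sol _ Jt|exact: val_inj].
Qed.

(** Poisson's equations say that [gamma] is rotated with angular velocity
    [(w1, w2, 0)], so a function of [gamma] evolves by the two rotation fields
    about the first and second axes, weighted by [w1] and [w2]. *)
Lemma is_derive_along_solution (R : realType) (I1 I2 : R) (U : 'rV[R]_3 -> R)
    (J : set R) (w1 w2 : R -> R) (g : R -> 'rV[R]_3) (mu : R -> R)
    (sol : suslov_solution I1 I2 U J w1 w2 g mu)
    (f : 'rV[R]_3 -> R) (t : R) :
  J t -> differentiable f (g t) ->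
  is_derive t 1 (fun s => f (g s))
    (w1 t * rotfield i3 i2 f (g t) + w2 t * rotfield i1 i3 f (g t)).
Proof.
move=> Jt df; have := is_derive_comp_rV (is_derive_poisson sol Jt) df.
rewrite sum_i123 !mxE /= => /is_derive_eq; apply.
by rewrite -!/(partial _ f (g t)) /rotfield; ring.
Qed.

Lemma continuous_rotfield_along_solution
    (R : realType) (I1 I2 : R) (U : 'rV[R]_3 -> R)
    (J : set R) (w1 w2 : R -> R) (g : R -> 'rV[R]_3) (mu : R -> R)
    (sol : suslov_solution I1 I2 U J w1 w2 g mu)
    (D : set 'rV[R]_3) (f : 'rV[R]_3 -> R) (i j : 'I_3) (t : R) :
  C1_on D f -> J t -> D (g t) ->
  {for t, continuous (fun s => rotfield i j f (g s))}.
Proof.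
move=> hf Jt Dt; have [_ cf] := hf _ Dt.
have cg : {for t, continuous g}.
  have [? _] := is_derive_poisson sol Jt.
  exact/differentiable_continuous/derivable1_diffP.
have coordc k : {for t, continuous (fun s => g s 0 k)}.
  by apply: (@continuous_comp _ _ _ g (fun x => x 0 k)) => //;
    exact: coord_continuous.
have pc k : {for t, continuous (fun s => partial k f (g s))}.
  by apply: (@continuous_comp _ _ _ g (partial k f)).
rewrite /rotfield; apply: cvgB; apply: cvgM;
  by [exact: coordc|exact: pc].
Qed.

(** * Invariance of the relations *)

Theorem proposition7p1 (R : realType) (I1 I2 h : R) (hI1 : 0 < I1) (hI2 : 0 < I2)
    (D : set 'rV[R]_3) (hD : open D)
    (mu1 mu2 U : 'rV[R]_3 -> R)
    (hmu1 : C1_on D mu1) (hmu2 : C1_on D mu2)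
    (hpde : forall x : 'rV[R]_3, D x ->
      x 0 i3 * (partial i2 mu1 x - partial i1 mu2 x)
        - x 0 i2 * partial i3 mu1 x + x 0 i1 * partial i3 mu2 x = 0)
    (hU : forall x : 'rV[R]_3, D x ->
      U x = (I1 * mu1 x ^+ 2 + I2 * mu2 x ^+ 2) / (2 * I1 * I2) - h) :
  suslov_admits_integrals I1 I2 U D
    (fun (w1 w2 : R) (x : 'rV[R]_3) => I1 * w1 = mu2 x /\ I2 * w2 = - mu1 x).
Proof.
have I10 : I1 != 0 by rewrite gt_eqF.
have I20 : I2 != 0 by rewrite gt_eqF.
move=> J w1 w2 g mu _ itvJ JD sol t0 Jt0 [P1 P2] t Jt.
pose A s := rotfield i3 i2 mu2 (g s).
pose B s := rotfield i3 i2 mu1 (g s).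
pose C s := rotfield i1 i3 mu1 (g s).
have BE s : J s -> rotfield i1 i3 mu2 (g s) = - B s.
  by move=> /JD/hpde; rewrite /B /rotfield; lra.
have rotU i j s : J s -> rotfield i j U (g s) =
    mu1 (g s) / I2 * rotfield i j mu1 (g s)
    + mu2 (g s) / I1 * rotfield i j mu2 (g s).
  move=> /JD Ds; have [d1 _] := hmu1 _ Ds; have [d2 _] := hmu2 _ Ds.
  rewrite /rotfield !(partial_quadratic_potential _ I10 I20 hD Ds d1 d2 hU).
  by ring.
pose p s := I1 * w1 s - mu2 (g s).
pose q s := I2 * w2 s + mu1 (g s).
have dp s : J s -> is_derive s 1 p (- (A s / I1) * p s + B s / I2 * q s).
  move=> Js; have [d2 _] := hmu2 _ (JD _ Js).
  have ? := suslov_w1 sol Js; have ? := is_derive_along_solution sol Js d2.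
  apply: is_derive_eq; rewrite /GRing.scale /= -/(rotfield i3 i2 U (g s)).
  rewrite rotU // BE // -/(A s) -/(B s) /p /q.
  by field; rewrite I10 I20.
have dq s : J s -> is_derive s 1 q (B s / I1 * p s + C s / I2 * q s).
  move=> Js; have [d1 _] := hmu1 _ (JD _ Js).
  have ? := suslov_w2 sol Js; have ? := is_derive_along_solution sol Js d1.
  apply: is_derive_eq; rewrite /GRing.scale /= -/(rotfield i1 i3 U (g s)).
  rewrite rotU // BE // -/(B s) -/(C s) /p /q.
  by field; rewrite I10 I20.
have cA s : J s -> {for s, continuous A}.
  by move=> Js; apply: (continuous_rotfield_along_solution sol hmu2) => //;
    exact: JD.
have cB s : J s -> {for s, continuous B}.
  by move=> Js; apply: (continuous_rotfield_along_solution sol hmu1) => //;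
    exact: JD.
have cC s : J s -> {for s, continuous C}.
  by move=> Js; apply: (continuous_rotfield_along_solution sol hmu1) => //;
    exact: JD.
have p0 : p t0 = 0 by rewrite /p P1 subrr.
have q0 : q t0 = 0 by rewrite /q P2 addNr.
have [| | | |/subr0_eq pt /eqP qt] :=
    linear_system2_eq0 itvJ _ _ _ _ dp dq Jt0 p0 q0 Jt.
- by move=> s Js; apply: cvgN; apply: cvgMl; exact: cA.
- by move=> s Js; apply: cvgMl; exact: cB.
- by move=> s Js; apply: cvgMl; exact: cB.
- by move=> s Js; apply: cvgMl; exact: cC.
by split=> //; apply/eqP; rewrite -addr_eq0.
Qed.
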